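(* Let $p>3$ be a prime. Then $$\sum_{k=0}^{(p-1)/2}\binom{2k}{k}\frac{T_{2k}(2,3)}{16^k}\equiv\sum_{k=0}^{(p-1)/2}\binom{2k}{k}\frac{T_{2k}(4,-3)}{16^k}\equiv\begin{cases}\left(\frac{-1}{p}\right)\left(\frac{x}{3}\right)\left(2x-\frac{2p}{x}\right)\pmod p&\text{if }p=x^2+3y^2\text{ with }x,y\in\mathbb{Z},\\ 0\pmod p&\text{if }p\equiv2\pmod3.\end{cases}$$
   Context: For integers $b,c$ and $n\ge0$, $T_n(b,c)$ is the coefficient of $x^n$ in $(x^2+bx+c)^n$, i.e. $T_n(b,c)=\sum_{j=0}^{\lfloor n/2\rfloor}\binom{n}{2j}\binom{2j}{j}b^{n-2j}c^j$. The symbols $\left(\frac{\cdot}{p}\right)$ and $\left(\frac{\cdot}{3}\right)$ are Legendre symbols. The congruence modulo $p$ is between rational numbers whose denominators are prime to $p$. *)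

(* Defs.v *)
From mathcomp Require Import all_boot all_order all_algebra.

Set Implicit Arguments.
Unset Strict Implicit.
Unset Printing Implicit Defensive.

Import Order.TTheory GRing.Theory Num.Theory.
Local Open Scope ring_scope.

Definition trinomialT (b c : int) (n : nat) : int :=
  (('X^2 + b *: 'X + c%:P) ^+ n : {poly int})`_n.

(* Meaningful only when q is an odd prime. *)
Definition legendre (a : int) (q : nat) : int :=
  if (q%:Z %| a)%Z then 0
  else if [exists z : 'I_q, (z%:Z ^+ 2 == a %[mod q%:Z])%Z] then 1 else -1.

(* Since [numq (r - s)] is the numerator in lowest terms, the last clause says
   that r - s lies in p Z_(p). *)
Definition rat_congr (p : nat) (r s : rat) : Prop :=
  [/\ coprime p `|denq r|, coprime p `|denq s|
    & (p%:Z %| numq (r - s))%Z].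

Definition sumT (p : nat) (b c : int) : rat :=
  \sum_(0 <= k < (p.-1)./2.+1)
    'C((2 * k)%N, k)%:R * (trinomialT b c (2 * k)%N)%:~R / 16%:R ^+ k.

(* Main.v *)
Require Import Defs.
From mathcomp Require Import all_boot all_order all_algebra.
From mathcomp Require Import all_solvable all_field.
From mathcomp Require Import zify ring.

Set Implicit Arguments.
Unset Strict Implicit.
Unset Printing Implicit Defensive.

Import Order.TTheory GRing.Theory Num.Theory.
Local Open Scope ring_scope.

(** Write [m = (p - 1) / 2] and [chi] for the quadratic character of ['F_p].  The
    weight [C(2k, k) / 16^k] is congruent to [C(m, k) (-1/4)^k], and [T_2k(b, c)] is a
    coefficient of a power of [Q = X^2 + b X + c], so the binomial theorem turns the
    whole sum into the coefficient of [X^(p - 1)] in [(X^2 - Q^2 / 4)^m].  Such a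
    coefficient is a power sum over ['F_p]; by Euler's criterion the sum is
    [(-1)^m (- 1 - S)], where [S] is the sum over [x] of
    [chi ((x^2 + (b - 2) x + c) (x^2 + (b + 2) x + c))]
    ([sum_binomial_trinomial], [reduces_to_sumT]).

    For [(b, c) = (2, 3)] and [(4, -3)] the quartic has a rational root.  Sending it
    to infinity gives the elliptic curves [y^2 = u^3 + 1] and
    [y^2 = v (v^2 + 6 v - 3)], which are 2-isogenous, so that both sums equal
    [- (-1)^m J] with [J] the sum of [chi (u^3 + 1)]
    ([sum_quadchar_isogeny], [reduces_to_sumT_2_3], [reduces_to_sumT_4_N3]).  This
    proves the first congruence.

    If [p] is 2 modulo 3, cubing is bijective and [J = 0].  If [p = x^2 + 3 y^2], then
    [p] is 1 modulo 3, and a linear relation and the second moment of the sums of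
    [chi (u^3 + a)], [a] varying, yield [4 p = J^2 + 3 B^2] ([cubic_sum1_norm]).  As [J] is even and is 1 modulo 3,
    uniqueness of the representation of [p] forces [- J = 2 x (x / 3)],
    with a Legendre symbol on the right ([cubic_sum1_repr]).  The term [2 p / x] vanishes modulo [p], and [(-1)^m] is the
    Legendre symbol of [-1]. *)

(** * Primitive roots of a finite field *)

Lemma card_finField_pred_gt0 (F : finFieldType) : (0 < #|F|.-1)%N.
Proof. by have := finNzRing_gt1 F; case: #|_| => [|[]]. Qed.

Lemma finField_prim_root (F : finFieldType) :
  exists g : F, #|F|.-1.-primitive_root g.
Proof.
have q1 := card_finField_pred_gt0 F.
pose s := enum [pred x : F | x != 0].
have sz : size s = #|F|.-1.
  by rewrite -cardE (cardD1 (0 : F) F) /=; apply: eq_card => x; rewrite !inE andbT.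
have roots_s : all #|F|.-1.-unity_root s.
  apply/allP => x; rewrite mem_enum inE => x0; rewrite unity_rootE.
  apply/eqP/(mulfI x0).
  rewrite -exprS prednK ?expf_card ?mulr1 //.
  exact: leq_trans q1 (leq_pred _).
have /hasP[g _ gP] : has #|F|.-1.-primitive_root s.
  by apply: (has_prim_root q1 roots_s); rewrite ?enum_uniq // sz.
by exists g.
Qed.

Lemma sum_periodic (V : nmodType) (f : nat -> V) d k :
  (forall i, f (i + d)%N = f i) ->
  \sum_(i < k * d) f i = (\sum_(i < d) f i) *+ k.
Proof.
move=> fd; have fkd k' i : f (i + k' * d)%N = f i.
  by elim: k' => [|k' IH]; rewrite ?mul0n ?addn0 // mulSn addnCA addnC fd.
elim: k => [|k IH]; first by rewrite mul0n big_ord0.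
rewrite mulSn addnC big_split_ord /= IH mulrSr; congr (_ + _).
by apply: eq_bigr => i _; rewrite addnC fkd.
Qed.

Section PrimRoot.
Variables (F : finFieldType) (g : F).
Hypothesis g_prim : #|F|.-1.-primitive_root g.

Lemma prim_root_neq0 i : g ^+ i != 0.
Proof.
apply: expf_neq0; apply/eqP => g0; have := prim_expr_order g_prim.
rewrite g0 expr0n eqn0Ngt (prim_order_gt0 g_prim) /= => /eqP.
by rewrite eq_sym oner_eq0.
Qed.

(** The powers of [g] enumerate the nonzero elements, so a sum over the latter is
    a sum over exponents; periodicity in the exponent can then be exploited by
    [sum_periodic]. *)
Lemma sum_neq0_prim_root (V : nmodType) (f : F -> V) :
  \sum_(a | a != 0) f a = \sum_(i < #|F|.-1) f (g ^+ i).
Proof.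
have inj : injective (fun i : 'I_#|F|.-1 => g ^+ i).
  move=> i j /eqP; rewrite (eq_prim_root_expr g_prim) !modn_small // => /eqP.
  exact: val_inj.
pose A := [set g ^+ (i : 'I_#|F|.-1) | i : 'I_#|F|.-1].
have AE : A = [set~ 0].
  apply/eqP; rewrite eqEcard; apply/andP; split.
    by apply/subsetP=> _ /imsetP[i _ ->]; rewrite !inE prim_root_neq0.
  by rewrite card_imset // card_ord cardsC1.
rewrite (eq_bigl (mem A)); last by move=> a; rewrite AE !inE.
by rewrite big_imset //=; move=> i j _ _; exact: inj.
Qed.

Lemma prim_root_gen a : a != 0 -> exists i, a = g ^+ i.
Proof.
move=> a0; have := sum_neq0_prim_root (fun b => (b == a : nat)).
rewrite (bigD1 a) //= eqxx => E.
case: (pickP (fun i : 'I_#|F|.-1 => g ^+ i == a)) => [i /eqP <-|no]; first by exists i.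
have E0 : \sum_(i < #|F|.-1) (g ^+ i == a : nat) = 0.
  by apply: big1 => i _; rewrite no.
by rewrite E0 in E.
Qed.

End PrimRoot.

(** * The quadratic character of a finite field of odd order *)

(** The values are integers and not elements of [F]: the quadratic identities for
    [cubic_sum] below are identities between integers and would be lost modulo
    the characteristic. *)
Definition quadchar (F : finFieldType) (a : F) : int :=
  if a == 0 then 0 else if [exists z, z ^+ 2 == a] then 1 else - 1.

Section QuadChar.
Variable F : finFieldType.
Hypothesis q_odd : odd #|F|.
Local Notation chi := (@quadchar F).
Local Notation q := #|F|.
Local Notation m := (q.-1)./2.

Let q_gt1 : (1 < q)%N. Proof. exact: finNzRing_gt1. Qed.
Let q1E : q.-1 = (m * 2)%N. Proof. by have := q_gt1; have := q_odd; lia. Qed.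
Let m_gt0 : (0 < m)%N. Proof. by have := q_gt1; have := q_odd; lia. Qed.

(** A square root of 1 other than 1, since [g] has order [2 * m]. *)
Lemma prim_root_half (g : F) : q.-1.-primitive_root g -> g ^+ m = -1.
Proof.
move=> gP; have : (g ^+ m) ^+ 2 == 1 by rewrite -exprM -q1E (prim_expr_order gP).
rewrite sqrf_eq1 => /orP[|/eqP //]; rewrite -(prim_order_dvd gP) q1E => /dvdn_leq; lia.
Qed.

Lemma odd_card_neg1 : (-1 : F) != 1.
Proof.
have [g gP] := finField_prim_root F.
rewrite -(prim_root_half gP) -(prim_order_dvd gP) q1E; apply/negP => /dvdn_leq; lia.
Qed.

Lemma odd_card_two : (2%:R : F) != 0.
Proof.
by apply: contra odd_card_neg1 => /eqP E; rewrite eq_sym -subr_eq0 opprK -E -natr1.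
Qed.

(** The powers of [g] with odd exponent are not squares because the order of [g]
    is even.  Every multiplicative property of [quadchar] is read off from this
    formula. *)
Lemma quadchar_prim_root (g : F) i : q.-1.-primitive_root g -> chi (g ^+ i) = (-1) ^+ i.
Proof.
move=> gP; rewrite /quadchar (negPf (prim_root_neq0 gP i)).
case: existsP => [[z /eqP zE] | no].
  have z0 : z != 0.
    by apply: contraTneq (prim_root_neq0 gP i) => z0; rewrite -zE z0 expr0n eqxx.
  case: (prim_root_gen gP z0) => j zj; move: zE; rewrite zj -exprM => /eqP.
  rewrite (eq_prim_root_expr gP) q1E => E.
  rewrite -signr_odd; suff -> : odd i = false by [].
  have := congr1 odd (eqP E); lia.
rewrite -signr_odd; suff -> : odd i by [].
apply/negP => /negP io; apply: no; exists (g ^+ i./2); rewrite -exprM; apply/eqP; congr (_ ^+ _).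
lia.
Qed.

Lemma quadchar0 : chi 0 = 0. Proof. by rewrite /quadchar eqxx. Qed.

Lemma quadchar1 : chi 1 = 1.
Proof.
rewrite /quadchar oner_eq0; case: existsP => // -[]; exists 1.
by rewrite expr1n.
Qed.

Lemma quadcharM : {morph chi : a b / a * b}.
Proof.
move=> a b; have [->|a0] := eqVneq a 0; first by rewrite mul0r quadchar0 mul0r.
have [->|b0] := eqVneq b 0; first by rewrite mulr0 quadchar0 mulr0.
have [g gP] := finField_prim_root F.
have [i ->] := prim_root_gen gP a0; have [j ->] := prim_root_gen gP b0.
by rewrite -exprD !quadchar_prim_root // exprD.
Qed.

Lemma quadcharX a n : chi (a ^+ n) = chi a ^+ n.
Proof. by elim: n => [|n IH]; rewrite ?quadchar1 // !exprS quadcharM IH. Qed.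

Lemma quadchar_sqr a : chi a ^+ 2 = (a != 0)%:Z.
Proof. by rewrite /quadchar; case: eqP => //= _; case: ifP. Qed.

Lemma quadchar_sqr1 a : a != 0 -> chi a ^+ 2 = 1.
Proof. by rewrite quadchar_sqr => ->. Qed.

(** Euler's criterion. *)
Lemma quadchar_exp a : (chi a)%:~R = a ^+ m.
Proof.
have [->|a0] := eqVneq a 0; first by rewrite quadchar0 expr0n -[m]prednK.
have [g gP] := finField_prim_root F.
have [i ->] := prim_root_gen gP a0.
rewrite quadchar_prim_root // -exprM mulnC exprM (prim_root_half gP).
by rewrite rmorphXn /= rmorphN.
Qed.

(** Multiplication by a primitive root changes the sign of every term. *)
Lemma sum_quadchar : \sum_a chi a = 0.
Proof.
have [g gP] := finField_prim_root F; have g0 := prim_root_neq0 gP 1.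
have : \sum_a chi a = - \sum_a chi a; last lia.
rewrite {1}(reindex_inj (mulfI g0)) /= -sumrN; apply: eq_bigr => a _.
by rewrite quadcharM quadchar_prim_root // expr1 mulN1r.
Qed.

Lemma sum_quadchar_shift c : \sum_a chi (a + c) = 0.
Proof. by rewrite -[RHS]sum_quadchar [RHS](reindex_inj (addIr c)). Qed.

Lemma card_sqrt d : (#|[pred z : F | z ^+ 2 == d]|)%:Z = 1 + chi d.
Proof.
have [->|d0] := eqVneq d 0.
  rewrite quadchar0 (@eq_card1 F 0) // => z; rewrite !inE.
  by rewrite expf_eq0.
rewrite /quadchar (negPf d0); case: existsP => [[z /eqP zE]|no]; last first.
  by rewrite eq_card0 // => z; rewrite !inE; apply/negP => zd; apply: no; exists z.
have z0 : z != 0 by apply: contraNneq d0 => z0; rewrite -zE z0 expr0n.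
rewrite (@eq_card F _ (pred2 z (- z))) => [|x]; last first.
  by rewrite !inE -zE eqf_sqr.
rewrite card2; suff -> : z != - z by [].
rewrite -subr_eq0 opprK -mulr2n -mulr_natl mulf_neq0 ?odd_card_two //.
Qed.

(** For [s != t], after the shift that makes [s] zero, the term at [a != 0] is
    [chi (1 + (t - s) / a)], and [c = (t - s) / a] runs over the nonzero elements:
    the complete sum of [chi (1 + c)] vanishes, and only the term at [c = 0] is
    missing. *)
Lemma sum_quadchar_mul s t :
  \sum_a chi (a + s) * chi (a + t) = q%:Z *+ (s == t) - 1.
Proof.
rewrite (reindex_inj (addIr (- s))) /=.
under eq_bigr => a _ do rewrite -[a - s + s]addrA addNr addr0 -addrA (addrC (- s)).
set d := t - s; have -> : (s == t) = (d == 0) by rewrite subr_eq0 eq_sym.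
rewrite (bigD1 0) //= quadchar0 mul0r add0r.
have [d0|d0] := eqVneq d 0.
  under eq_bigr => a a0 do rewrite d0 addr0 -expr2 quadchar_sqr1 //.
  rewrite sumr_const /= (_ : #|_| = q.-1); first by rewrite mulr1n !natz predn_int // ltnW.
  by rewrite (cardD1 (0 : F) F) /=; apply: eq_card => x; rewrite !inE andbT.
have -> : \sum_(a | a != 0) chi a * chi (a + d) = \sum_(c | c != 0) chi (c + 1).
  rewrite [RHS](reindex_onto (fun a => d / a) (fun c => d / c)) /=; last first.
    by move=> c c0; rewrite invf_div mulrCA divff // mulr1.
  apply: eq_big => [a|a a0].
    have [->|a0] := eqVneq a 0; first by rewrite invr0 mulr0 eqxx.
    by rewrite mulf_neq0 ?invr_neq0 // invf_div mulrCA divff // mulr1 eqxx.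
  have -> : d / a + 1 = (a * (a + d)) / a ^+ 2 by field.
  rewrite 2!quadcharM.
  suff -> : chi (a ^- 2) = 1 by rewrite mulr1.
  by rewrite -exprVn quadcharX quadchar_sqr1 // invr_neq0.
rewrite mulr0n sub0r; apply/eqP; rewrite -addr_eq0 addrC.
by have := sum_quadchar_shift 1; rewrite (bigD1 0) //= add0r quadchar1 => ->.
Qed.

(** The curves [y^2 = x (x^2 + a x + b)] and
    [y^2 = x (x^2 - 2 a x + a^2 - 4 b)] are 2-isogenous, hence have the same number
    of points.  Here is a direct reason: for [x != 0], dividing by the square [x^2]
    replaces the left summand by [chi (x + b / x + a)], and the value
    [t = x + b / x] is taken [1 + chi (t^2 - 4 b)] times.  The 1 contributes a
    vanishing sum, and what remains is the right-hand sum shifted by [a]. *)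
Lemma sum_quadchar_isogeny a b : b != 0 ->
  \sum_x chi (x * (x ^+ 2 + a * x + b))
  = \sum_x chi (x * (x ^+ 2 - 2%:R * a * x + (a ^+ 2 - 4%:R * b))).
Proof.
move=> b0; have two := odd_card_two.
have four : (4%:R : F) != 0 by rewrite -[4%N]/(2 * 2)%N natrM mulf_neq0.
transitivity (\sum_(x | x != 0) chi (x + b / x + a)).
  rewrite (bigD1 0) //= mul0r quadchar0 add0r; apply: eq_bigr => x x0.
  have -> : x * (x ^+ 2 + a * x + b) = x ^+ 2 * (x + b / x + a) by field.
  by rewrite quadcharM quadcharX quadchar_sqr1 // mul1r.
rewrite (partition_big (fun x => x + b / x) xpredT) //=.
have E t : \sum_(x | (x != 0) && (x + b / x == t)) chi (x + b / x + a)
   = chi (t + a) + chi (t + a) * chi (t ^+ 2 - 4%:R * b).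
  rewrite (eq_bigr (fun=> chi (t + a))) => [|x /andP[_ /eqP->] //].
  rewrite sumr_const -[RHS]/(_ + _) -{2}[chi (t + a)]mulr1 -mulrDr -card_sqrt.
  rewrite -[LHS]mulr_natr; congr (_ * _).
  rewrite natz; congr Posz.
  have inj : injective (fun x : F => 2%:R * x - t).
    by move=> x y /addIr /(mulfI two).
  (* Completing the square: [x^2 - t x + b = 0] means that [2 x - t] is a
     square root of the discriminant. *)
  rewrite -(card_image inj); apply: eq_card => z; rewrite [in RHS]inE.
  apply/imageP/eqP => [[x]|zE].
    case/andP=> x0 /eqP <- ->; field; exact: x0.
  exists ((z + t) / 2%:R); last by field.
  have xx : ((z + t) / 2%:R) ^+ 2 - t * ((z + t) / 2%:R) + b = 0.
    have -> : ((z + t) / 2%:R) ^+ 2 - t * ((z + t) / 2%:R) + b = (z ^+ 2 - (t ^+ 2 - 4%:R * b)) / 4%:R.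
      by field; rewrite ?two ?four.
    by rewrite zE subrr mul0r.
  have x0 : (z + t) / 2%:R != 0.
    by apply: contraNneq b0 => x0; move: xx; rewrite x0 mulr0 expr0n /= subr0 add0r => ->.
  apply/andP; split; first exact: x0.
  move: x0 xx; set x := (z + t) / 2%:R => x0 xx.
  rewrite -subr_eq0; have -> : x + b / x - t = (x ^+ 2 - t * x + b) / x by field.
  by rewrite xx mul0r.
rewrite (eq_bigr _ (fun t _ => E t)) big_split /= sum_quadchar_shift add0r.
rewrite (reindex_inj (addIr (- a))) /=; apply: eq_bigr => x _.
rewrite -quadcharM; congr chi; ring.
Qed.
End QuadChar.

(** * Cubic character sums *)

Definition cubic_sum (F : finFieldType) (a : F) : int :=
  \sum_u quadchar (u ^+ 3 + a).

Section CubicSum.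
Variable F : finFieldType.
Hypothesis q_odd : odd #|F|.
Local Notation chi := (@quadchar F).
Local Notation J := (@cubic_sum F).
Local Notation q := #|F|.

Lemma cubic_sumZ a c : c != 0 -> J (c ^+ 3 * a) = chi c * J a.
Proof.
move=> c0; rewrite /cubic_sum (reindex_inj (mulfI c0)) /= mulr_sumr.
apply: eq_bigr => u _; rewrite exprMn -mulrDr quadcharM // quadcharX //.
congr (_ * _); rewrite /quadchar (negPf c0); case: ifP => //.
Qed.

(** Cubing is a bijection, so the sum is that of [chi (u + 1)]. *)
Lemma cubic_sum1_eq0 : (q %% 3 = 2)%N -> J 1 = 0.
Proof.
move=> q2.
have inj : injective (fun u : F => u ^+ 3).
  apply: (can_inj (g := fun v => v ^+ ((q + q).-1 %/ 3))) => u.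
  have qE : (3 * ((q + q).-1 %/ 3)).+1 = (q + q)%N.
    by have := q2; have := q_odd; lia.
  have [->|u0] := eqVneq u 0.
    by rewrite -exprM expr0n; case: (_ * _)%N qE => //=; have := q_odd; lia.
  by apply: (mulfI u0); rewrite -exprM -exprS qE exprD expf_card.
by rewrite -[RHS](sum_quadchar_shift q_odd 1) [RHS](reindex_inj inj).
Qed.

Section OneModThree.
Variable n : nat.
Hypothesis q1E : #|F|.-1 = (n * 3)%N.

Variable g : F.
Hypothesis g_prim : q.-1.-primitive_root g.

Let n_gt0 : (0 < n)%N.
Proof. by have := card_finField_pred_gt0 F; rewrite q1E muln_gt0 => /andP[]. Qed.

(** Such an [f] depends only on the class of [a] modulo nonzero cubes, and the
    three classes, represented by 1, [g] and [g^2], have [n] elements each. *)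
Lemma sum_neq0_cube_invariant (f : F -> int) :
  (forall a, a != 0 -> f (g ^+ 3 * a) = f a) ->
  \sum_(a | a != 0) f a = (f 1 + f g + f (g ^+ 2)) *+ n.
Proof.
move=> fg; rewrite (sum_neq0_prim_root g_prim) q1E.
rewrite (@sum_periodic _ (fun i => f (g ^+ i))) => [|i].
  by rewrite !big_ord_recr big_ord0 /= add0r expr0 expr1.
by rewrite addnC exprD fg // prim_root_neq0.
Qed.

Lemma sum_cubes (f : F -> int) :
  \sum_(a | a != 0) f (a ^+ 3) = (\sum_(i < n) f (g ^+ (3 * i))) *+ 3.
Proof.
rewrite (sum_neq0_prim_root g_prim) q1E mulnC.
rewrite (@sum_periodic _ (fun i => f ((g ^+ i) ^+ 3))) => [|i].
  by congr (_ *+ _); apply: eq_bigr => i _; rewrite mulnC exprM.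
by rewrite exprD exprMn -[g ^+ n ^+ 3]exprM -q1E (prim_expr_order g_prim) mulr1.
Qed.

(** The terms with [u != 0] are grouped in triples with the same cube. *)
Lemma cubic_sum1_mod3 : exists k, J 1 = 1 + 3 * k.
Proof.
exists (\sum_(i < n) chi (g ^+ (3 * i) + 1)).
rewrite /cubic_sum (bigD1 0) //= expr0n add0r quadchar1; congr (_ + _).
by rewrite (sum_cubes (fun v => chi (v + 1))) -[LHS]mulr_natl.
Qed.

Lemma card_cube_roots c : c != 0 -> \sum_(u : F) (u ^+ 3 == c ^+ 3)%:Z = 3.
Proof.
move=> c0; rewrite (reindex_inj (mulfI c0)) /= (bigD1 0) //= mulr0 expr0n /=.
rewrite eq_sym expf_eq0 (negPf c0) /= add0r.
transitivity (\sum_(u : F | u != 0) (u ^+ 3 == 1)%:Z).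
  apply: eq_bigr => u _; rewrite exprMn -[X in _ == X]mulr1 (inj_eq (mulfI _)) //.
  exact: expf_neq0.
rewrite (sum_cubes (fun v : F => (v == 1)%:Z)).
rewrite (bigD1 (Ordinal n_gt0)) //= muln0 expr0 eqxx big1 ?addr0 // => i i0.
rewrite -(prim_order_dvd g_prim) q1E (mulnC n) dvdn_pmul2l //.
case: dvdnP => // -[k kE]; case: k kE => [|k] kE.
  by case/eqP: i0; apply: val_inj.
by have := ltn_ord i; rewrite kE mulSn ltnNge leq_addr.
Qed.

(** Modulo 2 each term is the indicator of [u^3 != -1], and exactly three of the
    [q] elements are excluded. *)
Lemma cubic_sum1_even : (2 %| J 1%R)%Z.
Proof.
have -> : J 1 = (J 1 - \sum_(u : F) (u ^+ 3 + 1 != 0)%:Z) + \sum_(u : F) (u ^+ 3 + 1 != 0)%:Z by rewrite subrK.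
apply: rpredD.
  rewrite /cubic_sum -sumrB; apply: rpred_sum => u _.
  by rewrite /quadchar; case: eqP => // _; case: ifP.
have -> : \sum_(u : F) (u ^+ 3 + 1 != 0)%:Z = q%:Z - 3.
  rewrite -(card_cube_roots (c := -1)) ?oppr_eq0 ?oner_eq0 //.
  have -> : q%:Z = \sum_(u : F) 1 by rewrite sumr_const natz.
  rewrite -sumrB; apply: eq_bigr => u _.
  by rewrite -[(-1) ^+ 3]signr_odd expr1 -[u ^+ 3 == -1]subr_eq0 opprK; case: eqP.
by rewrite -[_ \in _]/(2 %| q%:Z - 3)%Z; have := q_odd; lia.
Qed.

(** Summing first over [a], with [u] fixed, leaves the sum of [chi (s + a^2)] for
    [s = u^3], which is [q - 1] for [u = 0] and [-1] for each of the other [q - 1]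
    values of [u]. *)
Lemma sum_cubic_sum_sqr : \sum_a J (a ^+ 2) = 0.
Proof.
have E s : \sum_a chi (s + a ^+ 2) = q%:Z *+ (s == 0) - 1.
  rewrite -(sum_quadchar_mul q_odd s 0).
  have -> : \sum_a chi (s + a ^+ 2) = \sum_t \sum_(a | a ^+ 2 == t) chi (t + s).
    rewrite (partition_big (fun a => a ^+ 2) xpredT) //=.
    by apply: eq_bigr => t _; apply: eq_bigr => a /eqP ->; rewrite addrC.
  transitivity (\sum_t (chi (t + s) + chi (t + s) * chi (t + 0))).
    apply: eq_bigr => t _; rewrite sumr_const -{2}[chi (t + s)]mulr1 -mulrDr addr0.
    by rewrite -(card_sqrt q_odd) -[LHS]mulr_natr natz.
  by rewrite big_split /= sum_quadchar_shift // add0r.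
rewrite /cubic_sum exchange_big /= (eq_bigr _ (fun u _ => E (u ^+ 3))).
rewrite sumrB sumr_const /= (bigD1 0) //= expr0n eqxx big1 ?addr0 => [|u u0].
  by rewrite mulr1n natz subrr.
by rewrite expf_eq0 (negPf u0).
Qed.

Lemma cubic_sum0 : J 0 = 0.
Proof.
rewrite -[RHS](sum_quadchar q_odd); apply: eq_bigr => u _.
rewrite addr0 quadcharX // /quadchar; case: eqP => // _; case: ifP => //.
Qed.

(** Expanding the square and summing first over [a], [sum_quadchar_mul] leaves
    [q * N - q^2], where [N = 3 * q - 2] is the number of pairs with equal cubes. *)
Lemma sum_sqr_cubic_sum : \sum_a J a ^+ 2 = 2 * q%:Z * (q%:Z - 1).
Proof.
transitivity (\sum_u \sum_(v : F) (q%:Z *+ (v ^+ 3 == u ^+ 3) - 1)).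
  under eq_bigr => a _ do rewrite expr2 {2}/cubic_sum mulr_sumr.
  rewrite exchange_big /=; apply: eq_bigr => u _.
  under eq_bigr => a _ do rewrite /cubic_sum mulr_suml.
  rewrite exchange_big /=; apply: eq_bigr => v _.
  rewrite -sum_quadchar_mul //; apply: eq_bigr => a _.
  by rewrite ![a + _]addrC.
have E u : \sum_(v : F) (q%:Z *+ (v ^+ 3 == u ^+ 3) - 1)
           = q%:Z * (if u == 0 then 0 else 2).
  rewrite sumrB sumr_const !natz.
  under eq_bigr => v _ do rewrite -mulr_natr natz.
  rewrite -mulr_sumr; case: (eqVneq u 0) => [->|u0].
    rewrite (bigD1 0) //= eqxx big1 ?addr0 ?mulr1 ?subrr ?mulr0 // => v v0.
    by rewrite expr0n expf_eq0 (negPf v0).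
  by rewrite card_cube_roots //; ring.
rewrite (eq_bigr _ (fun u _ => E u)) -mulr_sumr (bigD1 0) //= eqxx add0r.
rewrite (eq_bigr (fun=> 2)) => [|u /negPf->] //.
rewrite sumr_const (_ : #|_| = q.-1).
  have -> : 2 *+ q.-1 = 2 * (q%:Z - 1).
    by rewrite -predn_int ?(ltnW (finNzRing_gt1 F)) // -[LHS]mulr_natr !natz.
  ring.
by rewrite (cardD1 (0 : F) F) /=; apply: eq_card => x; rewrite !inE andbT.
Qed.

(** The norm equation [|J|^2 = q] of a Jacobi sum, without cube roots of unity.
    By [cubic_sumZ] the values [J (a^2)] and [J a ^ 2] depend only on the class of [a]
    modulo cubes.  So the two moments above say that [K0 = J 1], [K1 = J (g^2)],
    [K2 = J (g^4)] satisfy [K0 + K1 + K2 = 0] and [K0^2 + K1^2 + K2^2 = 6 q].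
    Eliminating [K2] gives [12 q = 3 K0^2 + (K0 + 2 K1)^2], and the last square is
    a multiple of 9. *)
Lemma cubic_sum1_norm : exists B, 4 * q%:Z = J 1 ^+ 2 + 3 * B ^+ 2.
Proof.
have g0 : g != 0 by have := prim_root_neq0 g_prim 1; rewrite expr1.
have g30 : g ^+ 3 != 0 by rewrite expf_neq0.
have n0 : n%:Z != 0 by rewrite -lt0n.
set K0 := J 1; set K1 := J (g ^+ 2); set K2 := J (g ^+ 4).
have Kg a : J (g ^+ 6 * a) = J a.
  by rewrite (exprM g 2 3) cubic_sumZ ?expf_neq0 // quadcharX // quadchar_sqr1 // mul1r.
have S1 : K0 + K1 + K2 = 0.
  have := sum_cubic_sum_sqr.
  rewrite (bigD1 0) //= expr0n cubic_sum0 add0r sum_neq0_cube_invariant => [|a a0].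
    rewrite expr1n -exprM -/K0 -/K1 -/K2 -mulr_natr natz => /eqP.
    by rewrite mulf_eq0 (negPf n0) orbF => /eqP.
  by rewrite exprMn -exprM Kg.
have S2 : K0 ^+ 2 + K1 ^+ 2 + K2 ^+ 2 = 6 * q%:Z.
  have := sum_sqr_cubic_sum.
  rewrite (bigD1 0) //= cubic_sum0 expr0n add0r sum_neq0_cube_invariant => [|a a0].
    (* [g^4 = g^3 * g] lies in the class of [g]. *)
    have -> : J g ^+ 2 = K2 ^+ 2.
      by rewrite /K2 (exprSr g 3) cubic_sumZ // exprMn quadchar_sqr1 // mul1r.
    rewrite -/K0 -/K1 -predn_int ?(ltnW (finNzRing_gt1 F)) // q1E PoszM => E.
    rewrite -[LHS]mulr_natr natz addrAC in E.
    by apply: (mulIf n0); rewrite E; ring.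
  by rewrite cubic_sumZ // exprMn quadchar_sqr1 // mul1r.
have K2E : K2 = - (K0 + K1) by apply/eqP; rewrite -addr_eq0 addrC S1.
have D : (3 %| K0 + 2 * K1)%Z.
  have E : (K0 + 2 * K1) ^+ 2 = 3 * (4 * q%:Z - K0 ^+ 2).
    have -> : 3 * (4 * q%:Z - K0 ^+ 2) = 2 * (6 * q%:Z) - 3 * K0 ^+ 2 by ring.
    by rewrite -S2 K2E; ring.
  have : (3 %| (K0 + 2 * K1) ^+ 2)%Z by rewrite E dvdz_mulr.
  by rewrite !dvdzE abszX Euclid_dvdX // andbT.
case/dvdzP: D => B BE; exists B.
have K1E : 2 * K1 = B * 3 - K0 by rewrite -BE; ring.
apply: (mulfI (x := 6)) => //.
have -> : 6 * (4 * q%:Z) = 4 * (6 * q%:Z) by ring.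
rewrite -S2 K2E.
have -> : 4 * (K0 ^+ 2 + K1 ^+ 2 + (- (K0 + K1)) ^+ 2)
        = 4 * K0 ^+ 2 + (2 * K1) ^+ 2 + (2 * K0 + 2 * K1) ^+ 2 by ring.
by rewrite K1E; ring.
Qed.

End OneModThree.
End CubicSum.

(** * From trinomial coefficients to character sums *)

Lemma sum_finField_expr (F : finFieldType) i :
  \sum_(x : F) x ^+ i = - ((0 < i) && (#|F|.-1 %| i))%N%:R.
Proof.
have [g gP] := finField_prim_root F.
have q0 : (#|F|%:R : F) = 0.
  have : \sum_(x : F) x = \sum_(x : F) (x + 1) by rewrite [LHS](reindex_inj (addIr 1)).
  by rewrite big_split /= sumr_const -{1}[\sum_x x]addr0 => /addrI.
case: i => [|i]; first by rewrite (eq_bigr (fun=> 1)) // sumr_const oppr0 -[RHS]q0.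
rewrite (prim_order_dvd gP) /=; case: eqP => [gi|/eqP gi].
  rewrite (bigD1 0) //= expr0n add0r (eq_bigr (fun=> 1)) => [|x x0].
    apply/eqP; rewrite -addr_eq0 addrC -[X in _ == X]q0; apply/eqP.
    have -> : (#|F|%:R : F) = \sum_(x : F) 1 by rewrite sumr_const.
    by rewrite [RHS](bigD1 0).
  by have [j ->] := prim_root_gen gP x0; rewrite exprAC gi expr1n.
apply: (mulfI (x := 1 - g ^+ i.+1)); first by rewrite subr_eq0 eq_sym.
apply/eqP; rewrite oppr0 mulr0 mulrBl mul1r subr_eq0; apply/eqP.
rewrite [LHS](reindex_inj (mulfI (prim_root_neq0 gP 1))) /= mulr_sumr.
by apply: eq_bigr => x _; rewrite expr1 exprMn.
Qed.

(** Among the exponents up to [2 (q - 1)], only [q - 1] and [2 (q - 1)] have a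
    nonzero power sum. *)
Lemma sum_finField_horner (F : finFieldType) (G : {poly F}) :
  (size G <= (2 * #|F|.-1).+1)%N ->
  \sum_x G.[x] = - (G`_#|F|.-1 + G`_(2 * #|F|.-1)).
Proof.
move=> sG; have n0 := card_finField_pred_gt0 F.
rewrite (eq_bigr (fun x => \sum_(i < (2 * #|F|.-1).+1) G`_i * x ^+ i)) => [|x _]; last first.
  exact: horner_coef_wide.
rewrite exchange_big /=.
under eq_bigr => i _ do rewrite -mulr_sumr sum_finField_expr mulrN.
rewrite sumrN; congr (- _).
have ln : (#|F|.-1 < (2 * #|F|.-1).+1)%N by lia.
rewrite (bigD1 (Ordinal ln)) //= n0 dvdnn mulr1; congr (_ + _).
rewrite (bigD1 ord_max) /=; last first.
  by rewrite -val_eqE /= mul2n -addnn -[X in _ == X]addn0 eqn_add2l -lt0n.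
rewrite muln_gt0 n0 dvdn_mull //= mulr1 big1 ?addr0 // => i /andP[i1 i2].
case: dvdnP => [[k kE]|]; last by rewrite andbF mulr0.
move: i1 i2 (ltn_ord i); rewrite -!val_eqE /= kE ltnS.
case: k kE => [|[|[|k]]] kE; rewrite ?mul0n ?mul1n ?eqxx //= ?mulr0 //.
by rewrite leq_pmul2r.
Qed.

(** Multiplying [N ^ k] by ['X ^ (2 (m - k))] moves its coefficient of degree [2 k]
    to the fixed degree [2 m]; the binomial theorem then collects all terms into one
    power. *)
Lemma sum_trinomial_coef (F : fieldType) (N : {poly F}) (e : F) m :
  \sum_(k < m.+1) 'C(m, k)%:R * e ^+ k * (N ^+ k)`_(2 * k)
  = (('X^2 + e *: N) ^+ m)`_(2 * m).
Proof.
rewrite exprDn coef_sum; apply: eq_bigr => k _.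
have km : (k <= m)%N by rewrite -ltnS.
rewrite coefMn -exprM coefXnM ifF; last by lia.
rewrite exprZn coefZ (_ : 2 * m - 2 * (m - k) = 2 * k)%N; last by lia.
by rewrite -[RHS]mulr_natl mulrA.
Qed.

Definition quad_poly (F : fieldType) (b c : F) : {poly F} :=
  'X^2 + b *: 'X + c%:P.

Lemma size_quad_poly (F : fieldType) (b c : F) : size (quad_poly b c) = 3%N.
Proof.
rewrite /quad_poly -addrA size_polyDl size_polyXn // ltnS.
rewrite (leq_trans (size_polyD _ _)) // geq_max (leq_trans (size_scale_leq _ _)) ?size_polyX //.
by rewrite (leq_trans (size_polyC_leq1 _)).
Qed.

Lemma quad_poly_monic (F : fieldType) (b c : F) : quad_poly b c \is monic.
Proof.
rewrite monicE lead_coefE size_quad_poly /quad_poly !coefE /=; apply/eqP; ring.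
Qed.

Lemma horner_quad_poly (F : fieldType) (b c x : F) :
  (quad_poly b c).[x] = x ^+ 2 + b * x + c.
Proof. by rewrite /quad_poly !hornerE. Qed.

Lemma quad_polyDl (F : fieldType) (b e c : F) :
  quad_poly (b + e) c = quad_poly b c + e *: 'X.
Proof. by rewrite /quad_poly scalerDl addrA [RHS]addrAC. Qed.

Section QuarticSums.
Variable F : finFieldType.
Hypothesis q_odd : odd #|F|.
Local Notation chi := (@quadchar F).
Local Notation q := #|F|.
Local Notation m := (q.-1)./2.

(** With [Q] the quadratic polynomial, [sum_trinomial_coef] turns the left side
    into the coefficient of degree [q - 1] of [('X^2 - Q^2 / 4) ^ m].  The base is
    [-1/4] times the product [P] of the monic polynomials [Q - 2 'X] and [Q + 2 'X],
    and [(1/4) ^ m = 1].  The sum of [P ^ m] over the field is minus the sum of its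
    coefficients of degrees [q - 1] and [2 (q - 1)], the latter being 1, and by
    Euler's criterion it is the character sum on the right. *)
Lemma sum_binomial_trinomial (b c : F) :
  \sum_(k < m.+1) 'C(m, k)%:R * (- 4^-1) ^+ k * (quad_poly b c ^+ (2 * k))`_(2 * k)
  = (-1) ^+ m * (- 1 - (\sum_x chi ((x ^+ 2 + (b - 2) * x + c) * (x ^+ 2 + (b + 2) * x + c)))%:~R).
Proof.
have two : (2 : F) != 0 := odd_card_two q_odd.
have four : (4 : F) != 0 by rewrite -[4%N]/(2 * 2)%N natrM mulf_neq0.
have q1E : q.-1 = (2 * m)%N by have := q_odd; lia.
have e4 : (- 4^-1 : F) ^+ m = (-1) ^+ m.
  rewrite -[- 4^-1]mulN1r exprMn (_ : 4^-1 ^+ m = 1) ?mulr1 //.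
  rewrite -[4%N]/(2 ^ 2)%N natrX -exprVn -exprM -q1E.
  apply: (mulfI (x := 2^-1)); first by rewrite invr_eq0.
  rewrite -exprS prednK ?expf_card ?mulr1 //.
  exact: ltnW (finNzRing_gt1 F).
under eq_bigr => k _ do rewrite exprM.
rewrite sum_trinomial_coef.
have -> : 'X^2 + (- 4^-1) *: quad_poly b c ^+ 2
   = (- 4^-1) *: (quad_poly (b - 2) c * quad_poly (b + 2) c).
  rewrite !quad_polyDl (scaleNr 2) -subr_sqr exprZn !scaleNr scalerBr scalerA opprB.
  by rewrite -[2 ^+ 2]natrX mulVf // scale1r.
rewrite exprZn e4; set P := _ * _.
have Pm : P ^+ m \is monic by rewrite monic_exp // monicMl quad_poly_monic.
have sP : size (P ^+ m) = (2 * q.-1).+1.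
  rewrite (polySpred (monic_neq0 Pm)) size_exp.
  rewrite (size_monicM (quad_poly_monic _ _)) ?monic_neq0 ?quad_poly_monic // !size_quad_poly /=.
  by rewrite {2}q1E mulnA.
have := sum_finField_horner (eq_leq sP).
rewrite -q1E coefZ => /eqP; rewrite eq_sym eqr_oppLR => /eqP.
have -> : (P ^+ m)`_(2 * q.-1) = 1.
  by move: Pm; rewrite monicE lead_coefE sP => /eqP.
move/(canRL (addrK _)) => ->.
rewrite rmorph_sum /=; congr (_ * _); rewrite addrC; congr (_ - _).
apply: eq_bigr => x _; rewrite quadchar_exp // horner_exp; congr (_ ^+ _).
by rewrite hornerM !horner_quad_poly.
Qed.

(** A quartic with a root [r] becomes a cubic under [x = r + 1 / t].  The point
    [x = r] contributes nothing, and [t = 0] has to be taken away. *)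
Lemma sum_quadchar_quartic_root (P c : F -> F) r :
  P r = 0 -> (forall t, t != 0 -> t ^+ 4 * P (r + t^-1) = c t) ->
  \sum_x chi (P x) = \sum_t chi (c t) - chi (c 0).
Proof.
move=> Pr Pc; rewrite (bigD1 r) //= Pr quadchar0 add0r [in RHS](bigD1 0) //=.
rewrite addrC addrK.
rewrite (reindex_onto (fun t => r + t^-1) (fun x => (x - r)^-1)) /=; last first.
  by move=> x _; rewrite invrK addrC subrK.
apply: eq_big => [t|t].
  rewrite [r + _]addrC addrK invrK eqxx andbT -subr_eq0 addrK invr_eq0 //.
rewrite [r + _]addrC -subr_eq0 addrK invr_eq0 => /andP[t0 _].
rewrite addrC -Pc // quadcharM // (exprM t 2 2) (quadcharX q_odd) quadchar_sqr1 ?mul1r //.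
by rewrite expf_neq0.
Qed.

(** The quartic is [(x^2 + 3) (x + 1) (x + 3)], and the root [-1] leads to the
    cubic [(2 t)^3 + 1]. *)
Lemma sum_quadchar_quartic_2_3 :
  \sum_x chi ((x ^+ 2 + (2 - 2) * x + 3) * (x ^+ 2 + (2 + 2) * x + 3))
  = cubic_sum (1 : F) - 1.
Proof.
have two : (2 : F) != 0 := odd_card_two q_odd.
rewrite (sum_quadchar_quartic_root (c := fun t => (2 * t) ^+ 3 + 1) (r := -1)).
- rewrite mulr0 expr0n add0r quadchar1; congr (_ - _).
  by rewrite /cubic_sum [RHS](reindex_inj (mulfI two)).
- ring.
- by move=> t t0; field.
Qed.

(** The quartic is [(x + 3) (x - 1) (x^2 + 6 x - 3)], and the root 1 leads, with
    [v = 4 t + 1], to [v (v^2 + 6 v - 3)].  This is the case [a = 6], [b = -3] of the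
    isogeny, whose other side [s (s^2 - 12 s + 48)] is [64 (u^3 + 1)] for
    [s = 4 u + 4]. *)
Lemma sum_quadchar_quartic_4_N3 : (3 : F) != 0 ->
  \sum_x chi ((x ^+ 2 + (4 - 2) * x + - 3) * (x ^+ 2 + (4 + 2) * x + - 3))
  = cubic_sum (1 : F) - 1.
Proof.
move=> three; have two : (2 : F) != 0 := odd_card_two q_odd.
have four : (4 : F) != 0 by rewrite -[4%N]/(2 * 2)%N natrM mulf_neq0.
rewrite (sum_quadchar_quartic_root
  (c := fun t => (4 * t + 1) * (4 * t ^+ 2 + 8 * t + 1)) (r := 1)); last first.
- by move=> t t0; field.
- ring.
rewrite !mulr0 expr0n mulr0 !add0r mulr1 quadchar1; congr (_ - _).
transitivity (\sum_v chi (v * (v ^+ 2 + 6 * v + - 3))).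
  rewrite [RHS](reindex_inj (addIr 1)) [RHS](reindex_inj (mulfI four)) /=.
  apply: eq_bigr => t _.
  have -> : (4 * t + 1) * ((4 * t + 1) ^+ 2 + 6 * (4 * t + 1) + - 3)
    = 2 ^+ 2 * ((4 * t + 1) * (4 * t ^+ 2 + 8 * t + 1)) by ring.
  by rewrite [RHS](quadcharM q_odd) (quadcharX q_odd) quadchar_sqr1 ?mul1r.
rewrite sum_quadchar_isogeny ?oppr_eq0 //.
rewrite (reindex_inj (addIr 4)) (reindex_inj (mulfI four)) /=.
apply: eq_bigr => u _.
have -> : (4 * u + 4) * ((4 * u + 4) ^+ 2 - 2 * 6 * (4 * u + 4) + (6 ^+ 2 - 4 * - 3))
  = (2 ^+ 3) ^+ 2 * (u ^+ 3 + 1) by ring.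
by rewrite (quadcharM q_odd) (quadcharX q_odd) quadchar_sqr1 ?mul1r ?expf_neq0.
Qed.
End QuarticSums.

(** * Uniqueness of p = x^2 + 3 y^2 *)

(** The prime divides [(a y)^2 - (b x)^2 = p (y^2 - b^2)], hence one of the
    factors [a y - s b x] with [s = 1] or [s = -1].  By
    [p^2 = (a x + 3 s b y)^2 + 3 (a y - s b x)^2] this factor is too small to be a
    nonzero multiple of [p], so [(a y)^2 = (b x)^2]. *)
Lemma repr_sqr_3sqr_unique (p : nat) (x y a b : int) : prime p ->
  p%:Z = x ^+ 2 + 3 * y ^+ 2 -> p%:Z = a ^+ 2 + 3 * b ^+ 2 -> a ^+ 2 = x ^+ 2.
Proof.
move=> p_pr px pa; have p0 : p%:Z != 0 by rewrite -lt0n prime_gt0.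
have small s : s ^+ 2 = 1 -> (p %| a * y - s * (b * x))%Z -> a * y = s * (b * x).
  move=> s1 /dvdzP[t tE]; apply/eqP; rewrite -subr_eq0 tE mulf_eq0 (negPf p0) orbF.
  have E : p%:Z ^+ 2 = (a * x + 3 * s * (b * y)) ^+ 2 + 3 * (t * p%:Z) ^+ 2.
    rewrite -tE [LHS]expr2 {1}px pa.
    transitivity ((x ^+ 2 + 3 * y ^+ 2) * (a ^+ 2 + 3 * b ^+ 2)
      + (s ^+ 2 - 1) * (9 * (b * y) ^+ 2 + 3 * (b * x) ^+ 2)); last by ring.
    by rewrite s1 subrr mul0r addr0.
  case: (eqVneq t 0) => // t0.
  have t1 : 1 <= t ^+ 2 by rewrite -gtz0_ge1 exprn_even_gt0.
  have pp : 0 < p%:Z ^+ 2 by rewrite exprn_even_gt0.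
  have s0 := sqr_ge0 (a * x + 3 * s * (b * y)).
  have tp : p%:Z ^+ 2 <= (t * p%:Z) ^+ 2 by rewrite exprMn ler_peMl // ltW.
  move: E tp pp s0; move: (_ ^+ 2) ((_ + _) ^+ 2) ((t * _) ^+ 2) => w u v.
  by clear; lia.
have dvd : (p %| (a * y - 1 * (b * x)) * (a * y - (-1) * (b * x)))%Z.
  have -> : (a * y - 1 * (b * x)) * (a * y - (-1) * (b * x)) = p%:Z * (y ^+ 2 - b ^+ 2).
    by rewrite [RHS]mulrBr {1}pa px; ring.
  exact: dvdz_mulr.
have E : (a * y) ^+ 2 = (b * x) ^+ 2.
  move: dvd; rewrite dvdzE abszM Euclid_dvdM // => /orP[] /small ->; rewrite ?mul1r //.
  by rewrite mulN1r sqrrN.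
apply: (mulfI p0); rewrite {1}px pa.
have -> : (x ^+ 2 + 3 * y ^+ 2) * a ^+ 2 = x ^+ 2 * a ^+ 2 + 3 * (a * y) ^+ 2 by ring.
by rewrite E; ring.
Qed.

(** * Reduction of rational numbers modulo p *)

Section PrimeField.
Variable p : nat.
Hypothesis p_pr : prime p.

Lemma Fp_int_eq0 (n : int) : ((n%:~R : 'F_p) == 0) = (p %| n)%Z.
Proof. by rewrite (dvdz_pcharf (pchar_Fp p_pr)). Qed.

(** The fraction need not be in lowest terms, which makes compatibility with sums
    and products immediate; [reduces_to_num] recovers the statement about the
    reduced fraction. *)
Definition reduces_to (r : rat) (a : 'F_p) : Prop :=
  exists n d : int, [/\ r = n%:~R / d%:~R, (d%:~R : 'F_p) != 0 & a = n%:~R / d%:~R].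

Lemma Fp_int_neq0 (d : int) : (d%:~R : 'F_p) != 0 -> (d%:~R : rat) != 0.
Proof. by apply: contraNneq => /eqP; rewrite intr_eq0 => /eqP ->. Qed.

Lemma reduces_to_int n : reduces_to n%:~R n%:~R.
Proof. by exists n, 1; rewrite !divr1 oner_eq0. Qed.

Lemma reduces_toD r s a b :
  reduces_to r a -> reduces_to s b -> reduces_to (r + s) (a + b).
Proof.
move=> [n [d [-> d0 ->]]] [n' [d' [-> d'0 ->]]].
exists (n * d' + n' * d), (d * d'); rewrite !rmorphD !rmorphM /= mulf_neq0 //.
by rewrite !addf_div // Fp_int_neq0.
Qed.

Lemma reduces_toM r s a b :
  reduces_to r a -> reduces_to s b -> reduces_to (r * s) (a * b).
Proof.
move=> [n [d [-> d0 ->]]] [n' [d' [-> d'0 ->]]].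
by exists (n * n'), (d * d'); rewrite !rmorphM /= mulf_neq0 // !mulf_div.
Qed.

Lemma reduces_to_inv d : (d%:~R : 'F_p) != 0 -> reduces_to (d%:~R)^-1 (d%:~R)^-1.
Proof. by move=> d0; exists 1, d; rewrite !div1r. Qed.

Lemma reduces_toX r a k : reduces_to r a -> reduces_to (r ^+ k) (a ^+ k).
Proof.
move=> ra; elim: k => [|k IH]; first exact: (reduces_to_int 1).
by rewrite !exprS; apply: reduces_toM.
Qed.

Lemma reduces_to_num r a : reduces_to r a ->
  [/\ coprime p `|denq r| & (numq r)%:~R = a * (denq r)%:~R].
Proof.
move=> [n [d [rE d0 ->]]]; have dQ := Fp_int_neq0 d0.
have E : numq r * d = n * denq r.
  by apply: (@intr_inj rat); rewrite !rmorphM /= numqE rE; field.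
have Ep : (numq r)%:~R * d%:~R = n%:~R * (denq r)%:~R :> 'F_p by rewrite -!rmorphM E.
split; last by apply: (mulIf d0); rewrite Ep mulrAC divfK.
rewrite prime_coprime //; apply/negP => pd.
have dr0 : ((denq r)%:~R : 'F_p) = 0 by apply/eqP; rewrite Fp_int_eq0 dvdzE.
move/eqP: Ep; rewrite dr0 mulr0 mulf_eq0 (negPf d0) orbF Fp_int_eq0 dvdzE /= => pn.
have := coprime_num_den r; rewrite /coprime => /eqP g1.
by have := dvdn_gcd p `|numq r| `|denq r|; rewrite pn pd g1 dvdn1 gtn_eqF // prime_gt1.
Qed.

Lemma reduces_to_rat_congr r s a :
  reduces_to r a -> reduces_to s a -> rat_congr p r s.
Proof.
move=> ra sa; have [cr _] := reduces_to_num ra; have [cs _] := reduces_to_num sa.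
split=> //; rewrite -Fp_int_eq0.
have sa' : reduces_to (- s) (- a).
  by rewrite -mulN1r -[- a]mulN1r; apply: reduces_toM sa; apply: (reduces_to_int (-1)).
have [_ ->] := reduces_to_num (reduces_toD ra sa').
by rewrite subrr mul0r.
Qed.

Lemma legendre_quadchar (a : int) : legendre a p = quadchar (a%:~R : 'F_p).
Proof.
rewrite /legendre /quadchar Fp_int_eq0; case: ifP => // _; congr (if _ then _ else _).
have E (z : nat) : (z%:Z ^+ 2 == a %[mod p%:Z])%Z = (z%:R ^+ 2 == a%:~R :> 'F_p).
  by rewrite eqz_mod_dvd -Fp_int_eq0 rmorphB rmorphXn /= subr_eq0.
apply/existsP/existsP => -[z]; first by rewrite E => zE; exists z%:R.
have zp : (z < p)%N by have := ltn_ord z; rewrite [X in (_ < X)%N]Fp_cast.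
by move=> zE; exists (Ordinal zp); rewrite E /= natr_Zp.
Qed.

End PrimeField.

(** Euler's criterion modulo 3, where the exponent is 1. *)
Lemma legendre3_congr (x : int) : (3 %| x - legendre x 3)%Z.
Proof.
have odd3 : odd #|'F_3| by rewrite card_Fp.
rewrite -(@Fp_int_eq0 3) // rmorphB /= legendre_quadchar // quadchar_exp //.
by rewrite [#|_|]card_Fp // expr1 subrr.
Qed.

(** * The two sums modulo p *)

Section PrimeGt3.
Variable p : nat.
Hypothesis p_pr : prime p.
Hypothesis p_gt3 : (3 < p)%N.
Local Notation m := (p.-1)./2.

Let p_odd : odd p. Proof. by have [p2|//] := even_prime p_pr; move: p_gt3; rewrite p2. Qed.

Let Fp_odd : odd #|'F_p|. Proof. by rewrite card_Fp. Qed.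

Let small_neq0 (k : nat) : (0 < k < p)%N -> (k%:R : 'F_p) != 0.
Proof.
move=> /andP[k0 kp]; rewrite pmulrn Fp_int_eq0 //.
by rewrite dvdzE /= gtnNdvd.
Qed.

(** This is [C(2k, k) = (-4)^k C(-1/2, k)], since [m] is [-1/2] in ['F_p]. *)
Lemma central_binomial_Fp k : (k <= m)%N ->
  ('C(2 * k, k)%:R : 'F_p) = (- 4) ^+ k * 'C(m, k)%:R.
Proof.
elim: k => [|k IH] km; first by rewrite expr0 !bin0 mul1r.
have two : (2 : 'F_p) != 0 by apply: (small_neq0 (k := 2)); move: p_gt3; lia.
have mE : (m%:R : 'F_p) = - 2^-1.
  apply: (mulfI two); rewrite mulrN divff //; apply/eqP.
  by rewrite -addr_eq0 -natrM natr1 (_ : (2 * m).+1 = p) ?pchar_Fp_0 //; move: p_odd p_gt3; lia.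
have k0 : (k.+1%:R : 'F_p) != 0 by apply: small_neq0; lia.
apply: (mulfI k0).
have E1 : (k.+1 * 'C(2 * k.+1, k.+1) = 2 * (2 * k + 1) * 'C(2 * k, k))%N.
  have down := mul_bin_down (2 * k).+1 k; rewrite /= in down.
  rewrite mulnS -mul_bin_diag /= add1n -[in LHS]mulnS -mulnA -[in RHS]mulnA addn1 down.
  by congr (2 * (_ * _))%N; lia.
have E2 : (k.+1%:R * 'C(m, k.+1)%:R : 'F_p) = (m%:R - k%:R) * 'C(m, k)%:R.
  by rewrite -natrM mul_bin_left natrM natrB // ltnW.
rewrite [RHS]mulrCA -[LHS]natrM E1 E2 !natrM IH ?(ltnW km) // mE exprS natrD natrM.
by field.
Qed.

Lemma trinomialT_Fp b c k :
  ((trinomialT b c k)%:~R : 'F_p) = (quad_poly b%:~R c%:~R ^+ k)`_k.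
Proof.
rewrite /trinomialT /quad_poly -[LHS]coef_map rmorphXn /= !rmorphD /=.
by rewrite map_polyXn map_polyZ map_polyX map_polyC.
Qed.

(** By [central_binomial_Fp] the factor [C(2k, k) / 16^k] becomes
    [C(m, k) (-1/4)^k], the weight in [sum_binomial_trinomial]. *)
Lemma reduces_to_sumT b c : @reduces_to p (sumT p b c)
  ((-1) ^+ m * (- 1 - (\sum_(x : 'F_p) quadchar
     ((x ^+ 2 + (b%:~R - 2) * x + c%:~R) * (x ^+ 2 + (b%:~R + 2) * x + c%:~R)))%:~R)).
Proof.
have := sum_binomial_trinomial Fp_odd b%:~R c%:~R; rewrite [#|_|]card_Fp // => <-.
rewrite /sumT big_mkord.
apply: (big_ind2 (@reduces_to p)) => [|r a s a'|k _]; first exact: (reduces_to_int p 0).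
  exact: reduces_toD.
have four : (4 : 'F_p) != 0 by apply: (small_neq0 (k := 4)); move: p_odd p_gt3; lia.
have s16 : (16 : 'F_p) = 4 * 4 by rewrite -natrM.
have -> : 'C(m, k)%:R * (- 4^-1) ^+ k = 'C(2 * k, k)%:R * (16%:R^-1) ^+ k :> 'F_p.
  rewrite central_binomial_Fp; last by rewrite -ltnS.
  rewrite [LHS]mulrC [RHS]mulrAC -exprMn; congr (_ ^+ _ * _).
  by rewrite s16 invfM mulrA mulNr divff // mulN1r.
rewrite -trinomialT_Fp -exprVn [X in reduces_to _ X]mulrAC.
apply: reduces_toM; first exact: reduces_toM (reduces_to_int p 'C(2 * k, k)) (reduces_to_int p _).
by apply: reduces_toX; rewrite !pmulrn; apply: reduces_to_inv; rewrite -pmulrn s16 mulf_neq0.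
Qed.

Lemma reduces_to_sumT_cubic (b c : int) (b' c' : 'F_p) :
  b%:~R = b' -> c%:~R = c' ->
  \sum_x quadchar ((x ^+ 2 + (b' - 2) * x + c') * (x ^+ 2 + (b' + 2) * x + c'))
  = cubic_sum (1 : 'F_p) - 1 ->
  @reduces_to p (sumT p b c) (((-1) ^+ m * - cubic_sum (1 : 'F_p))%:~R).
Proof.
move=> <- <- E; have := reduces_to_sumT b c; rewrite E.
congr reduces_to; rewrite [RHS]rmorphM rmorphXn /= rmorphN rmorphB /= rmorphN /= rmorph1.
by congr (_ * _); ring.
Qed.

Lemma reduces_to_sumT_2_3 :
  @reduces_to p (sumT p 2 3) (((-1) ^+ m * - cubic_sum (1 : 'F_p))%:~R).
Proof.
by apply: reduces_to_sumT_cubic (sum_quadchar_quartic_2_3 Fp_odd); rewrite -pmulrn.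
Qed.

Lemma reduces_to_sumT_4_N3 :
  @reduces_to p (sumT p 4 (- 3)) (((-1) ^+ m * - cubic_sum (1 : 'F_p))%:~R).
Proof.
have three : (3 : 'F_p) != 0 by apply: (small_neq0 (k := 3)); move: p_gt3; lia.
apply: reduces_to_sumT_cubic (sum_quadchar_quartic_4_N3 Fp_odd three).
  by rewrite -pmulrn.
by rewrite rmorphN /= -pmulrn.
Qed.

(** Both [p = x^2 + 3 y^2] and [4 p = J^2 + 3 B^2] hold.  Since [J] is even, so is
    [B], and uniqueness of the representation gives [J / 2 = x] or [J / 2 = - x].  The
    sign follows from [J = 1] modulo 3. *)
Lemma cubic_sum1_repr (x y : int) : p%:Z = x ^+ 2 + 3 * y ^+ 2 ->
  - cubic_sum (1 : 'F_p) = 2 * x * legendre x 3.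
Proof.
move=> px.
have [g gP] := finField_prim_root 'F_p.
have p3 : (3 %| p)%N = false by rewrite dvdn_prime2 //; move: p_gt3; lia.
have x3 : (3 %| x)%Z = false.
  by apply/negP => /dvdzP[z xE]; move: px p3; rewrite xE expr2; lia.
have p1 : (p.-1 = p.-1 %/ 3 * 3)%N.
  rewrite divnK //; have := divz_eq x 3; set k := (x %/ 3)%Z => xE.
  have : (x %% 3 = 1)%Z \/ (x %% 3 = 2)%Z by move: x3; lia.
  by case=> xr; move: px; rewrite xE xr expr2; have := prime_gt0 p_pr; lia.
have q1 : #|'F_p|.-1 = (p.-1 %/ 3 * 3)%N by rewrite card_Fp.
have [k JE] := cubic_sum1_mod3 q1 gP.
have /dvdzP[a Ja] := cubic_sum1_even Fp_odd q1 gP.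
have [B norm] := cubic_sum1_norm Fp_odd q1 gP.
rewrite card_Fp // in norm.
move: JE Ja norm; set J := cubic_sum _ => JE Ja norm.
have /dvdzP[b Bb] : (2 %| B)%Z.
  have : (2 %| B ^+ 2)%Z by move: norm; rewrite Ja exprMn; lia.
  by rewrite !dvdzE abszX Euclid_dvdX // andbT.
have pa : p%:Z = a ^+ 2 + 3 * b ^+ 2 by move: norm; rewrite Ja Bb !exprMn; lia.
have /eqP := repr_sqr_3sqr_unique p_pr px pa.
have L3 := legendre3_congr x.
have : legendre x 3 = 1 \/ legendre x 3 = -1.
  by rewrite /legendre x3; case: ifP; [left | right].
clear norm; move=> L1; rewrite eqf_sqr => ax; move: JE Ja L3 L1 ax.
move: J (legendre x 3) => J' L; clear.
by move=> -> /esym Ja L3 [] LE /orP[] /eqP ax; move: L3; rewrite LE; lia.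
Qed.

Lemma repr_sqr_3sqr_Fp_neq0 (x y : int) :
  p%:Z = x ^+ 2 + 3 * y ^+ 2 -> (x%:~R : 'F_p) != 0.
Proof.
move=> px; rewrite (Fp_int_eq0 p_pr); apply/negP => /dvdzP[t xt].
have p3 : (3 %| p)%N = false by rewrite dvdn_prime2 //; move: p_gt3; lia.
have t0 : t != 0 by apply: contraFneq p3 => t0; move: px; rewrite xt t0; lia.
have t1 : 1 <= t ^+ 2 by rewrite -gtz0_ge1 exprn_even_gt0.
have y0 := sqr_ge0 y.
by move: px p_gt3 t1 y0; rewrite xt exprMn; nia.
Qed.

End PrimeGt3.

Theorem corollary5p13 (p : nat) (p_prime : prime p) (p_gt3 : (3 < p)%N) :
  [/\ rat_congr p (sumT p 2 3) (sumT p 4 (- 3)),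
      forall x y : int, p%:Z = x ^+ 2 + 3 * y ^+ 2 ->
        rat_congr p (sumT p 4 (- 3))
          ((legendre (-1) p)%:~R * (legendre x 3)%:~R
             * (2 * x%:~R - 2 * p%:R / x%:~R))
    & p = 2 %[mod 3] -> rat_congr p (sumT p 4 (- 3)) 0].
Proof.
have Fp_odd : odd #|'F_p|.
  by rewrite card_Fp //; have [p2|//] := even_prime p_prime; rewrite p2 in p_gt3.
have S1 := reduces_to_sumT_2_3 p_prime p_gt3.
have S2 := reduces_to_sumT_4_N3 p_prime p_gt3.
split; first exact: (reduces_to_rat_congr p_prime S1 S2).
  move=> x y pE; apply: (reduces_to_rat_congr p_prime S2).
  have x0 := repr_sqr_3sqr_Fp_neq0 p_prime p_gt3 pE.
  rewrite (cubic_sum1_repr p_prime p_gt3 pE).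
  have := reduces_toM (reduces_toM (reduces_to_int p (legendre (-1) p))
    (reduces_to_int p (legendre x 3))) (reduces_toD (reduces_to_int p (2 * x))
    (reduces_toM (reduces_to_int p (- (2 * p%:Z))) (reduces_to_inv x0))).
  congr reduces_to; first by rewrite mulrNz !intrM mulNr.
  have p0 : (p%:Z%:~R : 'F_p) = 0 by apply/eqP; rewrite (Fp_int_eq0 p_prime).
  rewrite legendre_quadchar // quadchar_exp // [#|_|]card_Fp //.
  rewrite mulrNz !intrM p0 mulr0 oppr0 mul0r addr0 [in RHS]rmorphXn /= rmorphN /= rmorph1.
  by ring.
move=> p2; apply: (reduces_to_rat_congr p_prime S2).
rewrite cubic_sum1_eq0 // ?card_Fp //.
by rewrite oppr0 mulr0; exact: (reduces_to_int p 0).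
Qed.
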